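(* Let $(X_t)_{t \in \mathbb{N}}$ be a random process over $\mathbb{R}$, let $x_{\min} > 0$, and let $T = \inf\{t \mid X_t \leq x_{\min}\}$. Furthermore, suppose that, (a) for all $t \leq T$, it holds that $X_t \geq x_{\min}$, and that (b) there is some value $\delta > 0$ such that, for all $t < T$, it holds that $X_t - \mathrm{E}[X_{t+1} \mid X_0, \ldots, X_t] \geq \delta X_t$. Then $$\mathrm{E}[T \mid X_0] \leq \frac{\ln\left(\frac{X_0}{x_{\min}}\right)}{\delta}.$$
   Context: $\mathbb{N}$ includes $0$. $\inf\emptyset := \infty$, so $T$ takes values in $\mathbb{N} \cup \{\infty\}$. Conditional expectations given $X_0,\ldots,X_t$ (respectively $X_0$) are random variables, taken with respect to the $\sigma$-algebra generated by these variables; (in)equalities between random variables are understood almost surely. Since $T$ is a random variable, a requirement stated ''for all $t < T$'' (respectively ''for all $t \le T$'') means formally that, for every $t \in \mathbb{N}$, both sides of the inequality are multiplied by the indicator function of the event $\{t < T\}$ (respectively $\{t \le T\}$); i.e., the inequality only has to hold on that event. *)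

(* Defs.v *)
From HB Require Import structures.
From mathcomp Require Import all_boot all_order all_algebra.
From mathcomp Require Import all_classical all_reals all_analysis.
From mathcomp Require Import measurable_realfun.

Set Implicit Arguments.
Unset Strict Implicit.
Unset Printing Implicit Defensive.

Import Order.TTheory GRing.Theory Num.Theory.
Import numFieldNormedType.Exports.

Local Open Scope classical_set_scope.
Local Open Scope ring_scope.
Local Open Scope ereal_scope.

Section conditional_expectation.
Context d (T : measurableType d) (R : realType).
Variables (P : probability T R) (G : set (set T)).

(* [g] is a version of E[f | sigma(G)], for [f] with values in [0, +oo]; no
   integrability of [f] is required, so [g] may take the value +oo. *)
Definition is_condexp_ge0 (f g : T -> \bar R) : Prop :=
  [/\ @measurable_fun _ _ (g_sigma_algebraType G) (\bar R) setT g,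
      forall w, 0 <= g w &
      forall A, G.-sigma.-measurable A ->
        \int[P]_(w in A) g w = \int[P]_(w in A) f w].

(* The default value of [xget] is never used when [f] is nonnegative and
   measurable and [G] consists of events: see [condexp_ge0P] below. *)
Definition condexp_ge0 (f : T -> \bar R) : T -> \bar R :=
  xget (cst 0) [set g | is_condexp_ge0 f g].

(* E[f | sigma(G)] for a possibly non-integrable [f]: it is meaningful at every
   point where the conditional expectations of the positive and negative parts
   are not both +oo (where the difference would be the dummy value -oo).  For
   integrable [f] it is almost surely the usual conditional expectation. *)
Definition condexp (f : T -> \bar R) : T -> \bar R :=
  condexp_ge0 f^\+ \- condexp_ge0 f^\-.

End conditional_expectation.

Section condexp_existence.
Context d (T : measurableType d) (R : realType).
Variables (P : probability T R) (G : set (set T)).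
Hypothesis GT : G `<=` d.-measurable.

Let T' := g_sigma_algebraType G.
Let phi : T -> T' := idfun.

Let sGT A : G.-sigma.-measurable A -> d.-measurable A.
Proof. by apply: smallest_sub => //; exact: sigma_algebra_measurable. Qed.

Let mphi : measurable_fun setT phi.
Proof. by move=> _ A mA; rewrite setTI; exact: sGT. Qed.

Let phi_mfun : {mfun T >-> T'} :=
  HB.pack phi (isMeasurableFun.Build _ _ _ _ phi mphi).

Let mGT (g : T -> \bar R) :
  @measurable_fun _ _ T' (\bar R) setT g -> measurable_fun setT g.
Proof. by move=> mg _ A mA; apply: sGT; exact: mg. Qed.

Section bounded.
Variables (h : T -> \bar R) (M : R).
Hypotheses (mh : measurable_fun setT h) (h0 : forall w, 0 <= h w).
Hypothesis hM : forall w, h w <= M%:E.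

Let nu (A : set T') := \int[P]_(w in A) h w.

Let nu0 : nu set0 = 0. Proof. exact: integral_set0. Qed.

Let nu_ge0 A : 0 <= nu A.
Proof. by apply: integral_ge0 => w _; exact: h0. Qed.

Let nu_sigma_additive : semi_sigma_additive nu.
Proof.
move=> F mF tF mUF.
apply: (semi_sigma_additive_nng_induced mh h0 _ tF); last exact: sGT.
by move=> n; exact: sGT.
Qed.

Let nu_mixin := isMeasure.Build _ _ _ nu nu0 nu_ge0 nu_sigma_additive.
Let nu_measure : {measure set T' -> \bar R} := HB.pack nu nu_mixin.

Let nu_fin : fin_num_fun nu_measure.
Proof.
move=> A mA; rewrite ge0_fin_numE; last exact: nu_ge0.
apply: (@le_lt_trans _ _ (\int[P]_(w in A) (cst M%:E w))).
  by apply: ge0_le_integral => //; [exact: sGT|exact: measurable_funTS].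
rewrite integral_cst; last exact: sGT.
apply: (@le_lt_trans _ _ `|M|%:E); last exact: ltry.
apply: (@le_trans _ _ (`|M|%:E * P A)).
  by rewrite lee_wpmul2r// lee_fin ler_norm.
by rewrite -[leRHS]mule1 lee_wpmul2l//; exact/probability_le1/sGT.
Qed.

Let nu_finite_measure : {finite_measure set T' -> \bar R} :=
  HB.pack nu nu_mixin (Measure_isFinite.Build _ _ _ nu_measure nu_fin).

Lemma is_condexp_ge0_bounded : exists g, is_condexp_ge0 P G h g.
Proof.
pose mu : probability T' R := distribution P phi_mfun.
have numu : nu_finite_measure `<< mu.
  apply/null_content_dominatesP => A mA PA0.
  by apply: null_set_integral; [exact: sGT|exact: measurable_funTS|exact: PA0].
have [g [g0 gfin intg nug]] := radon_nikodym_sigma_finite numu.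
have mg : measurable_fun setT g by exact: measurable_int intg.
exists g; split => // A mA.
rewrite -[RHS]/(nu_finite_measure A) nug// [RHS]ge0_integral_pushforward//.
exact: measurable_funTS.
Qed.

End bounded.

Section truncation.
Variable f : T -> \bar R.
Hypotheses (mf : measurable_fun setT f) (f0 : forall w, 0 <= f w).

Let u n w : \bar R := mine (f w) n%:R%:E.
Let h n w := u n.+1 w - u n w.

Let u_fin n w : u n w \is a fin_num.
Proof.
rewrite ge0_fin_numE; last by rewrite /u le_min f0 lee_fin ler0n.
by rewrite /u gt_min ltry orbT.
Qed.

Let h0 n w : 0 <= h n w.
Proof.
rewrite /h sube_ge0 ?u_fin//= /u le_min ge_min lexx/= ge_min lee_fin.
by rewrite ler_nat leqnSn orbT.
Qed.

Let hM n w : h n w <= n.+1%:R%:E.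
Proof.
rewrite /h leeBlDr ?u_fin// (@le_trans _ _ n.+1%:R%:E)//.
  by rewrite /u ge_min lexx orbT.
by rewrite leeDl// /u le_min f0 lee_fin ler0n.
Qed.

Let mh n : measurable_fun setT (h n).
Proof.
by apply: emeasurable_funB; apply: measurable_mine => //; exact: measurable_cst.
Qed.

Let sum_h n w : \sum_(0 <= k < n) h k w = u n w.
Proof.
elim: n => [|n IH]; first by rewrite big_nil /u; apply/esym/min_idPr.
by rewrite big_nat_recr//= IH /h addeC subeK ?u_fin.
Qed.

Let fE w : f w = \sum_(n <oo) h n w.
Proof.
apply/eqP; rewrite eq_le; apply/andP; split; last first.
  apply: lime_le; first by apply: is_cvg_nneseries => n _ _; exact: h0.
  by apply: nearW => n; rewrite sum_h /u ge_min lexx.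
have le_u n : u n w <= \sum_(n <oo) h n w.
  by rewrite -sum_h; apply: nneseries_lim_ge => k _ _; exact: h0.
have [foo|ffin] := eqVneq (f w) +oo.
  rewrite foo leye_eq; apply/eqP/eqyP => A A0.
  rewrite (le_trans _ (le_u (Num.truncn A).+1))// /u foo minye lee_fin.
  by rewrite ltW// truncnS_gt.
have {}ffin : f w \is a fin_num by rewrite ge0_fin_numE// ltey.
rewrite (le_trans _ (le_u (Num.truncn (fine (f w))).+1))// /u le_min lexx/=.
by rewrite -[leLHS]fineK// lee_fin ltW// truncnS_gt.
Qed.

Lemma is_condexp_ge0_exists : exists g, is_condexp_ge0 P G f g.
Proof.
have /choice[g hg] n : exists g, is_condexp_ge0 P G (h n) g.
  exact: is_condexp_ge0_bounded (mh n) (h0 n) (hM n).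
have mg n : @measurable_fun _ _ T' _ setT (g n) by case: (hg n).
have g0 n w : 0 <= g n w by case: (hg n).
exists (fun w => \sum_(n <oo) g n w); split.
- exact: (@ge0_emeasurable_sum _ T' _ setT g xpredT).
- by move=> w; apply: nneseries_ge0 => n _ _; exact: g0.
- move=> A mA; have mA' := sGT mA.
  rewrite integral_nneseries//; last by move=> n; exact/measurable_funTS/mGT.
  under [RHS]eq_integral do rewrite fE.
  rewrite integral_nneseries//; last by move=> n; exact: measurable_funTS.
  by apply: eq_eseriesr => n _; case: (hg n) => _ _; exact.
Qed.

Lemma condexp_ge0P : is_condexp_ge0 P G f (condexp_ge0 P G f).
Proof. exact: (xgetPex (cst 0) is_condexp_ge0_exists). Qed.

End truncation.
End condexp_existence.

Section processes.
Context d (T : measurableType d) (R : realType).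

(* A generator of sigma(X_0, ..., X_t); it is already a sigma-algebra. *)
Definition history (X : nat -> T -> R) (t : nat) : set (set T) :=
  g_sigma_preimage (fun i : 'I_t.+1 => X i).

Lemma history_measurable (X : nat -> T -> R) (t : nat) :
  (forall i, measurable_fun setT (X i)) -> history X t `<=` d.-measurable.
Proof.
move=> mX; apply: smallest_sub; first exact: sigma_algebra_measurable.
apply: (big_ind (fun C => C `<=` d.-measurable)) => //.
- by move=> C D CT DT A [/CT|/DT].
- by move=> i _ A [B mB <-]; exact: mX.
Qed.

(* The first time at which the process is at most [a]; the infimum is taken in
   the extended reals, so it is +oo if there is no such time. *)
Definition hitting_time (X : nat -> T -> R) (a : R) (w : T) : \bar R :=
  ereal_inf [set t%:R%:E | t in [set t : nat | (X t w <= a)%R]].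

End processes.

(* Main.v *)
Require Import Defs.
From HB Require Import structures.
From mathcomp Require Import all_boot all_order all_algebra.
From mathcomp Require Import all_classical all_reals all_analysis measurable_realfun.
From mathcomp Require Import lra ring.

Import Order.TTheory GRing.Theory Num.Theory.
Import numFieldNormedType.Exports.

(** Multiplicative drift becomes additive after taking logarithms.  Write
   $L_t = \ln(\max(X_t, x_{\min}) / x_{\min}) \geq 0$.  On the event
   $\{t < T\}$ the bound $\ln u \leq u - 1$ at $u = X_{t+1}/X_t$ gives
   $L_{t+1} + 1 \leq L_t + X_{t+1}/X_t$, and the drift condition says that the
   conditional mean of $X_{t+1}/X_t$ is at most $1 - \delta$; hence $L$ loses
   at least $\delta$ per step in mean.

   Everything is carried out with integrals of nonnegative functions over events
   $E$ of $\sigma(X_0, \dots, X_t)$ contained in $\{t < T\}$, so that all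
   integrals make sense in $[0, +\infty]$:
   [log_drift_integral] is the inequality
   $\int_E L_{t+1} + \delta P(E) \leq \int_E L_t$.  It rests on
   [drift_integral], the integrated form of the drift condition, and on
   [le_integral_weight], which lets one divide by the known quantity $X_t$
   inside the integrals (it plays the part of taking out what is known).

   For $B \in \sigma(X_0)$, telescoping over $E_t = B \cap \{t < T\}$ and
   $T = \sum_t 1_{\{t < T\}}$ give
   $\delta \int_B T \leq \int_B L_0$ ([integral_hitting_time_le]); since $B$
   is arbitrary, [ae_le_integral] turns this into the almost sure bound
   $\mathrm{E}[T \mid X_0] \leq L_0 / \delta$, and $L_0 = \ln(X_0/x_{\min})$
   because $X_0 \geq x_{\min}$ almost surely. *)

Local Open Scope classical_set_scope.
Local Open Scope ring_scope.
Local Open Scope ereal_scope.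

(** * Comparing integrals over a sub-sigma-algebra *)

Section sub_sigma_algebra_integrals.
Context {d} {T : measurableType d} {R : realType}.
Context (mu : {measure set T -> \bar R}) {G : set (set T)}.
Context (GT : G `<=` d.-measurable).

Lemma sub_gsigma_measurable {A} : G.-sigma.-measurable A -> d.-measurable A.
Proof. by apply: smallest_sub => //; exact: sigma_algebra_measurable. Qed.

Lemma sub_gsigma_measurable_fun {d'} {U : measurableType d'}
    {D : set T} {h : T -> U} :
  @measurable_fun _ _ (g_sigma_algebraType G) U D h ->
  G.-sigma.-measurable D -> measurable_fun D h.
Proof. by move=> mh mD _ A mA; apply: sub_gsigma_measurable; exact: mh. Qed.

Import HBNNSimple.

Lemma integral_nnsfun_weight (s : {nnsfun g_sigma_algebraType G >-> R})
    (D : set T) (f : T -> R) :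
  G.-sigma.-measurable D -> measurable_fun setT f ->
  (forall w, D w -> (0 <= f w)%R) ->
  \int[mu]_(w in D) (s w * f w)%:E =
  \sum_(y \in range s) y%:E * \int[mu]_(w in D `&` s @^-1` [set y]) (f w)%:E.
Proof.
move=> mD mf f0; have mD' := sub_gsigma_measurable mD.
(* The type of [I y] selects the large sigma-algebra on [T]; the preimage alone
   would be read in the small one. *)
pose I (y : R) : set T := s @^-1` [set y].
have mI y : measurable (I y).
  by apply: sub_gsigma_measurable; rewrite -[X in _ X]setTI; exact: measurable_funP.
have mfD : measurable_fun D f by exact: measurable_funTS.
have s_ge0 y w : 0 <= (y * \1_(I y) w)%:E by exact: nnfun_muleindic_ge0.
have ms y : measurable_fun D (fun w => (y * \1_(I y) w)%:E).
  exact/measurable_EFinP/measurable_funM.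
transitivity (\int[mu]_(w in D) \sum_(y \in range s)
    ((y * \1_(I y) w)%:E * (f w)%:E)).
  apply: eq_integral => w _; rewrite EFinM [X in X%:E * _](fimfunE s w) -fsumEFin//.
  by rewrite ge0_mule_fsuml.
rewrite ge0_integral_fsum//=; first last.
- by move=> y w Dw; rewrite mule_ge0// lee_fin f0.
- by move=> y; apply: emeasurable_funM => //; exact/measurable_EFinP.
apply: eq_fsbigr => y /[!inE] -[w0 _ <-].
rewrite -ge0_integralZl//; first last.
- by rewrite lee_fin.
- by move=> w [Dw _]; rewrite lee_fin f0.
- by apply/measurable_EFinP; exact: measurable_funTS.
- exact: (measurableI _ _ mD' (mI (s w0))).
rewrite integral_mkcondr; apply: eq_integral => w _.
rewrite epatch_indic EFinM [RHS]muleAC muleC; congr (_ * _).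
Qed.

(** Monotone convergence along simple functions that are measurable for the
   small sigma-algebra: the values of the approximation are then taken on events
   where integrals of [f] can be compared. *)
Lemma cvg_integral_weight (D : set T) (f h : T -> R)
    (mD : G.-sigma.-measurable D)
    (mh : @measurable_fun _ _ (g_sigma_algebraType G) _ D (EFin \o h)) :
  measurable_fun setT f -> (forall w, D w -> (0 <= f w)%R) ->
  (forall w, D w -> (0 <= h w)%R) ->
  \int[mu]_(w in D) (nnsfun_approx mD mh n w * f w)%:E @[n --> \oo] -->
  \int[mu]_(w in D) (h w * f w)%:E.
Proof.
move=> mf f0 h0; have mD' := sub_gsigma_measurable mD.
have -> : \int[mu]_(w in D) (h w * f w)%:E =
    \int[mu]_(w in D) limn (fun n => (nnsfun_approx mD mh n w * f w)%:E).
  apply: eq_integral => w /[!inE] Dw; apply/esym/cvg_lim => //.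
  under eq_fun do rewrite EFinM.
  rewrite EFinM; apply: cvgeZr => //.
  by apply: (@cvg_nnsfun_approx _ _ _ _ mD _ mh) => // v Dv; rewrite lee_fin h0.
apply: cvg_monotone_convergence => //.
- move=> n; apply/measurable_EFinP/measurable_funM; last exact: measurable_funTS.
  by apply: sub_gsigma_measurable_fun => //; exact: measurable_funTS.
- by move=> n w Dw; rewrite lee_fin mulr_ge0// f0.
- move=> w Dw m n mn; rewrite lee_fin ler_wpM2r ?f0//.
  by have /lefP := nd_nnsfun_approx mD mh mn; exact.
Qed.

(** Weighting by a function that is measurable for the small sigma-algebra
   preserves an inequality known on all events of that sigma-algebra: both sides
   are limits of nonnegative combinations of such integrals. *)
Lemma le_integral_weight (D : set T) (f k h : T -> R) :
  G.-sigma.-measurable D ->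
  @measurable_fun _ _ (g_sigma_algebraType G) _ D h ->
  measurable_fun setT f -> measurable_fun setT k ->
  (forall w, D w -> (0 <= f w)%R) -> (forall w, D w -> (0 <= k w)%R) ->
  (forall w, D w -> (0 <= h w)%R) ->
  (forall A, G.-sigma.-measurable A -> A `<=` D ->
    \int[mu]_(w in A) (f w)%:E <= \int[mu]_(w in A) (k w)%:E) ->
  \int[mu]_(w in D) (h w * f w)%:E <= \int[mu]_(w in D) (h w * k w)%:E.
Proof.
move=> mD /measurable_EFinP mh mf mk f0 k0 h0 fk.
have cf := cvg_integral_weight _ _ _ mD mh mf f0 h0.
have ck := cvg_integral_weight _ _ _ mD mh mk k0 h0.
apply: (lee_cvg_to cf ck); apply: nearW => n.
rewrite !integral_nnsfun_weight//; apply: lee_fsum => // y -[w0 _ <-].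
rewrite lee_wpmul2l ?lee_fin//; apply: fk; last exact: subIsetl.
apply: measurableI => //.
Qed.
End sub_sigma_algebra_integrals.

(** The set where [g] exceeds [h] is a countable union of the events
   $A_n = \{g \geq h + 1/(n+1), h \leq n\}$; on $A_n$ the integral of [h] is
   finite, so the gap $P(A_n)/(n+1)$ has to vanish. *)
Lemma ae_le_integral {d} {T : measurableType d} {R : realType}
    {P : probability T R} {G : set (set T)} {g : T -> \bar R} {h : T -> R} :
  G `<=` d.-measurable ->
  @measurable_fun _ _ (g_sigma_algebraType G) _ setT g ->
  @measurable_fun _ _ (g_sigma_algebraType G) _ setT h ->
  (forall w, 0 <= g w) -> (forall w, (0 <= h w)%R) ->
  (forall A, G.-sigma.-measurable A ->
    \int[P]_(w in A) g w <= \int[P]_(w in A) (h w)%:E) ->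
  {ae P, forall w, g w <= (h w)%:E}.
Proof.
move=> GT mg mh g0 h0 gh.
pose e n : R := n.+1%:R^-1%R.
have e_gt0 n : (0 < e n)%R by rewrite invr_gt0 ltr0n.
pose A n : set T := [set w | (h w + e n)%:E <= g w] `&` [set w | (h w)%:E <= n%:R%:E].
have mA n : G.-sigma.-measurable (A n).
  apply: measurableI; rewrite -[X in _ X]setTI.
    apply: (@measurable_lee _ (g_sigma_algebraType G)) => //.
    by apply/measurable_EFinP; exact: measurable_funD.
  apply: (@measurable_lee _ (g_sigma_algebraType G)) => //.
  exact/measurable_EFinP.
have mA' n := sub_gsigma_measurable GT (mA n).
have sub_fun d' (U : measurableType d') (k : T -> U) :
  @measurable_fun _ _ (g_sigma_algebraType G) _ setT k -> measurable_fun setT k.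
  by move=> mk; apply: (sub_gsigma_measurable_fun GT).
have A0 n : P (A n) = 0.
  have mhA : measurable_fun (A n) (fun w => (h w)%:E).
    by apply/measurable_EFinP/measurable_funTS/sub_fun.
  have fin_h : \int[P]_(w in A n) (h w)%:E \is a fin_num.
    rewrite ge0_fin_numE; last by apply: integral_ge0 => w _; rewrite lee_fin.
    apply: (@le_lt_trans _ _ (\int[P]_(w in A n) (cst n%:R%:E w))).
      apply: ge0_le_integral => // w; first by rewrite lee_fin.
      by case.
    rewrite integral_cst//.
    apply: (@le_lt_trans _ _ (n%:R%:E)); last exact: ltry.
    by rewrite -[leRHS]mule1 lee_wpmul2l ?lee_fin//; exact: probability_le1.
  have : \int[P]_(w in A n) (h w)%:E + (e n)%:E * P (A n) <=
         \int[P]_(w in A n) (h w)%:E.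
    apply: le_trans (gh _ (mA n)).
    rewrite -integral_cst// -ge0_integralD//=; first last.
    - by move=> w _; rewrite lee_fin ltW.
    - by move=> w _; rewrite lee_fin.
    apply: ge0_le_integral => //.
    - by move=> w _; rewrite -EFinD lee_fin addr_ge0// ltW.
    - by apply: emeasurable_funD.
    - by apply: measurable_funTS; exact: sub_fun.
    - by move=> w [].
  rewrite -[leRHS]adde0 leeD2lE// pmule_rle0 ?lte_fin// => PA0.
  by apply/eqP; rewrite eq_le PA0 measure_ge0.
have : P.-negligible (\bigcup_n A n).
  apply: negligible_bigcup => n; exists (A n); split; [exact: mA'|exact: A0|by []].
apply: negligibleS.
move=> w /= /negP; rewrite -ltNge => hg.
have [n [hn gn]] : exists n, (h w <= n%:R)%R /\ (h w + e n)%:E <= g w.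
  have [r rh rg] : exists2 r : R, (h w < r)%R & r%:E <= g w.
    case: (g w) hg => [r| |//].
      by rewrite lte_fin => hr; exists r.
    by move=> _; exists (h w + 1)%R; rewrite ?leey// ltrDl.
  have rh0 : (0 < r - h w)%R by rewrite subr_gt0.
  pose m1 := (Num.truncn (h w)).+1; pose m2 := (Num.truncn (r - h w)^-1).+1.
  exists (maxn m1 m2); split.
    rewrite (@le_trans _ _ m1%:R)//; first by rewrite ltW// truncnS_gt.
    by rewrite ler_nat leq_maxl.
  apply: le_trans rg; rewrite lee_fin -lerBrDl /e invf_ple ?posrE ?ltr0n//.
  rewrite (@le_trans _ _ m2%:R)//; first by rewrite ltW// truncnS_gt.
  by rewrite ler_nat (leq_trans (leq_maxr m1 m2)).
by exists n => //; split => //=; rewrite lee_fin.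
Qed.

(** * Hitting times *)

Section hitting_times.
Context {d} {T : measurableType d} {R : realType}.
Implicit Types (X : nat -> T -> R) (a : R).

Lemma measurable_history X {t i} : (i <= t)%N ->
  @measurable_fun _ _ (g_sigma_algebraType (history X t)) R setT (X i).
Proof.
move=> it _ A mA; apply: sub_sigma_algebra; apply: sub_sigma_algebra.
rewrite -bigcup_mkord_ord; exists i; first by rewrite /= ltnS.
by exists A => //; rewrite inordK.
Qed.

Lemma history_le X {s t} : (s <= t)%N ->
  (history X s).-sigma.-measurable `<=` (history X t).-sigma.-measurable.
Proof.
move=> st; apply: smallest_sub; first exact: sigma_algebra_measurable.
apply: smallest_sub; first exact: sigma_algebra_measurable.
apply: (big_ind (fun C => C `<=` (history X t).-sigma.-measurable)) => //.
- by move=> C D CT DT A [/CT|/DT].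
- move=> i _ A [B mB <-]; apply: measurable_history => //.
  by rewrite (leq_trans _ st)// -ltnS.
Qed.

(** This is the event $\{t < T\}$ ([lt_hitting_time]), in a form that
   visibly depends on $X_0, \dots, X_t$ only. *)
Definition stays_above X a t : set T := [set w | forall i, (i <= t)%N -> (a < X i w)%R].

Lemma measurable_stays_above X a t : (history X t).-sigma.-measurable (stays_above X a t).
Proof.
have -> : stays_above X a t = \bigcap_(i in `I_t.+1) (X i @^-1` `]a, +oo[).
  apply/seteqP; split => w /= H i; first by move=> it; rewrite /= in_itv/= andbT; exact: H.
  by move=> it; have /= := H i it; rewrite in_itv/= andbT.
apply: bigcap_measurable => [|i it]; first by exists 0%N.
rewrite -[X in _ X]setTI; apply: measurable_history => //.
Qed.

Lemma lt_hitting_time {X a t w} :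
  (t%:R%:E < hitting_time X a w) <-> stays_above X a t w.
Proof.
split=> [tT i it|abv].
  rewrite ltNge; apply/negP => Xi; move: tT; rewrite ltNge => /negP; apply.
  apply: (@le_trans _ _ i%:R%:E); last by rewrite lee_fin ler_nat.
  by apply: ereal_inf_lbound; exists i.
apply: (@lt_le_trans _ _ t.+1%:R%:E); first by rewrite lte_fin ltr_nat.
apply: le_ereal_inf_tmp => _ [i /= Xi <-]; rewrite lee_fin ler_nat ltnNge.
by apply/negP => it; have := abv i it; rewrite ltNge Xi.
Qed.

Lemma stays_above_le_hitting_time {X a t w} :
  stays_above X a t w -> t.+1%:R%:E <= hitting_time X a w.
Proof.
move=> abv.
apply: le_ereal_inf_tmp => _ [i /= Xi <-]; rewrite lee_fin ler_nat ltnNge.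
by apply/negP => it; have := abv i it; rewrite ltNge Xi.
Qed.

Lemma hitting_time_ge0 X a w : 0 <= hitting_time X a w.
Proof. by apply: le_ereal_inf_tmp => _ [i /= Xi <-]; rewrite lee_fin. Qed.

(** Tail sum formula: the events $\{t < T\}$ decrease with $t$, and exactly
   $T$ of them occur. *)
Lemma hitting_time_series X a w :
  hitting_time X a w = \sum_(t <oo) (\1_(stays_above X a t) w)%:E.
Proof.
have [[m Xm]|noX] := pselect (exists t, (X t w <= a)%R).
  have exX : exists t, (X t w <= a)%R by exists m.
  case: (ex_minnP exX) => {Xm}m Xm mmin.
  have aboveE t : \1_(stays_above X a t) w = (t < m)%:R :> R.
    rewrite indicE; congr (_%:R); congr nat_of_bool.
    apply/idP/idP => [/[!inE] abv|tm].
      by rewrite ltnNge; apply/negP => /abv; rewrite ltNge Xm.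
    rewrite inE => i it; rewrite ltNge; apply/negP => /mmin.
    by rewrite leqNgt (leq_ltn_trans it).
  have -> : hitting_time X a w = m%:R%:E.
    apply/eqP; rewrite eq_le; apply/andP; split.
      by apply: ereal_inf_lbound; exists m.
    by apply: le_ereal_inf_tmp => _ [i /= /mmin im <-]; rewrite lee_fin ler_nat.
  apply/esym; rewrite (nneseries_split _ m); last by move=> k _; rewrite lee_fin.
  rewrite [X in _ + X]eseries0 ?adde0; last first.
    by move=> k mk _; rewrite aboveE ltnNge mk.
  rewrite add0n sumEFin; congr _%:E.
  rewrite (eq_big_nat _ _ (F2 := fun=> 1%R)); last first.
    by move=> k /= km; rewrite aboveE km.
  by rewrite big_const_nat iter_addr_0 subn0.
rewrite (_ : hitting_time X a w = +oo); last first.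
  by apply/ereal_inf_pinfty => _ [t Xt <-]; case: noX; exists t.
apply/esym/eqyP => A A0.
apply: (@le_trans _ _ (\sum_(0 <= t < (Num.truncn A).+1) (\1_(stays_above X a t) w)%:E)).
  rewrite (eq_big_nat _ _ (F2 := fun=> 1%E)); last first.
    move=> k _; rewrite indicE mem_set// => i _.
    by rewrite ltNge; apply/negP => Xi; apply: noX; exists i.
  rewrite sumEFin big_const_nat iter_addr_0 subn0 lee_fin ltW//.
  exact: truncnS_gt.
by apply: nneseries_lim_ge => k _ _; rewrite lee_fin.
Qed.

End hitting_times.

(** * The logarithmic potential *)

Section drift.
Context {d} {T : measurableType d} {R : realType}.
Context (P : probability T R) (X : nat -> T -> R) (a delta : R).
Context (mX : forall t, measurable_fun setT (X t)).
Context (a_gt0 : (0 < a)%R) (delta_gt0 : (0 < delta)%R).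
Context (Xge : forall t,
  {ae P, forall w, t%:R%:E <= hitting_time X a w -> (a <= X t w)%R}).
Context (drift : forall t,
  {ae P, forall w, t%:R%:E < hitting_time X a w ->
    (X t w)%:E - condexp P (history X t) (EFin \o X t.+1) w
      >= (delta * X t w)%:E}).

Let GT t : history X t `<=` d.-measurable := @history_measurable _ T R X t mX.

(** On the event $\{t < T\}$ the variable $X_{t+1}$ is almost surely at least
   $a > 0$, so its negative part contributes nothing to the integral.  Replacing
   $X_{t+1}$ by $\max(X_{t+1}, a)$ changes no integral over [A] and makes the
   integrand positive everywhere. *)
Lemma drift_integral t (A : set T) :
  (history X t).-sigma.-measurable A -> A `<=` stays_above X a t ->
  \int[P]_(w in A) (Num.max (X t.+1 w) a + delta * X t w)%:E <=
  \int[P]_(w in A) (X t w)%:E.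
Proof.
move=> mA Aabove; have mA' := sub_gsigma_measurable (GT t) mA.
have X_gt0 w : A w -> (0 < X t w)%R.
  by move=> /Aabove/(_ t (leqnn t)); exact: lt_trans.
pose f := EFin \o X t.+1.
have mf : measurable_fun setT f by exact/measurable_EFinP.
have [mp p0 intp] := condexp_ge0P P (GT t)
  (measurable_funepos mf) (fun w => funepos_ge0 f w).
have [mn n0 intn] := condexp_ge0P P (GT t)
  (measurable_funeneg mf) (fun w => funeneg_ge0 f w).
set p := condexp_ge0 P (history X t) f^\+ in mp p0 intp.
set n := condexp_ge0 P (history X t) f^\- in mn n0 intn.
have mpA : measurable_fun A p.
  by apply: measurable_funTS; exact: (sub_gsigma_measurable_fun (GT t) mp).
have mnA : measurable_fun A n.
  by apply: measurable_funTS; exact: (sub_gsigma_measurable_fun (GT t) mn).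
have mXA i : measurable_fun A (X i) by exact: measurable_funTS.
have X1ge : {ae P, forall w, A w -> (a <= X t.+1 w)%R}.
  apply: filterS (Xge t.+1) => w + Aw; apply.
  exact/stays_above_le_hitting_time/Aabove.
have intmax : \int[P]_(w in A) (Num.max (X t.+1 w) a)%:E = \int[P]_(w in A) p w.
  rewrite intp//; apply: ge0_ae_eq_integral => //.
  - by apply/measurable_EFinP/measurable_maxr.
  - by apply: measurable_funTS; exact: measurable_funepos.
  - by move=> w _; rewrite lee_fin le_max (ltW a_gt0) orbT.
  - apply: filterS X1ge => w + Aw => /(_ Aw) aX.
    by rewrite funeposE /f /= max_l// -EFin_max max_l// (le_trans (ltW a_gt0)).
have intn0 : \int[P]_(w in A) n w = 0.
  rewrite intn//; transitivity (\int[P]_(w in A) (cst 0 w)).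
    apply: ge0_ae_eq_integral => //.
    - by apply: measurable_funTS; exact: measurable_funeneg.
    - apply: filterS X1ge => w + Aw => /(_ Aw) aX.
      rewrite funenegE /f /= max_r// lee_fin oppr_le0.
      by rewrite (le_trans (ltW a_gt0)).
  by rewrite integral0.
have mdX : measurable_fun A (fun w => (delta * X t w)%:E).
  by apply/measurable_EFinP; apply: measurable_funM.
have dX0 w : A w -> 0 <= (delta * X t w)%:E.
  by move=> Aw; rewrite lee_fin mulr_ge0// ltW// X_gt0.
under eq_integral do rewrite EFinD.
rewrite ge0_integralD//; first last.
- by apply/measurable_EFinP/measurable_maxr.
- by move=> w _; rewrite lee_fin le_max (ltW a_gt0) orbT.
rewrite intmax -ge0_integralD//.
rewrite -[leRHS]adde0 -intn0 -ge0_integralD//; first last.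
- exact/measurable_EFinP.
- by move=> w Aw; rewrite lee_fin ltW// X_gt0.
apply: ae_ge0_le_integral => //.
- by move=> w Aw; rewrite adde_ge0// dX0.
- exact: emeasurable_funD.
- by move=> w Aw; rewrite adde_ge0// lee_fin ltW// X_gt0.
- by apply: emeasurable_funD => //; exact/measurable_EFinP.
apply: filterS (drift t) => w + Aw.
have /lt_hitting_time tT := Aabove _ Aw.
move=> /(_ tT); rewrite /condexp -/f /= -/p -/n.
have := p0 w; have := n0 w.
(* If $n = +\infty$ the bound is trivial, and $p = +\infty$ with $n$ finite
   would make the conditional drift $-\infty$. *)
case: (n w) (p w) => [y| |] [x| |]//=; rewrite ?addey// ?lee_fin => _ _ h; [lra|exact: leey].
Qed.

Definition potential (x : R) : R := ln (Num.max x a / a).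

Lemma potential_ge0 x : (0 <= potential x)%R.
Proof. by rewrite ln_ge0// ler_pdivlMr// mul1r le_max lexx orbT. Qed.

Lemma measurable_potential : measurable_fun setT potential.
Proof.
apply: measurableT_comp; first exact: measurable_ln.
by apply: measurable_funM => //; exact: measurable_maxr.
Qed.

(** This is $\ln u \leq u - 1$ at $u = \max(y, a) / x$, written without
   subtraction so that it can be integrated term by term. *)
Lemma potential_le x y : (0 < x)%R -> (a < x)%R ->
  (potential y + 1 <= potential x + x^-1 * Num.max y a)%R.
Proof.
move=> x0 ax; rewrite /potential (max_l (ltW ax)).
set z := Num.max y a.
have z0 : (0 < z)%R by rewrite lt_max a_gt0 orbT.
have -> : (z / a = x / a * (x^-1 * z))%R by field; rewrite !gt_eqF.
rewrite lnM ?posrE ?divr_gt0 ?mulr_gt0 ?invr_gt0// -addrA lerD2l.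
have := @le_ln1Dx R (x^-1 * z - 1).
have : (0 < x^-1 * z)%R by rewrite mulr_gt0 ?invr_gt0.
set u := (x^-1 * z)%R => u0.
rewrite (_ : 1 + (u - 1) = u)%R; last by ring.
by move=> /(_ ltac:(lra)); lra.
Qed.

(** Integrate [potential_le] over [E] and bound the ratio term by dividing
   [drift_integral] by $X_t$; the leftover constant $P(E)$ on both sides is
   finite and cancels. *)
Lemma log_drift_integral t (E : set T) :
  (history X t).-sigma.-measurable E -> E `<=` stays_above X a t ->
  \int[P]_(w in E) (potential (X t.+1 w))%:E + delta%:E * P E <=
  \int[P]_(w in E) (potential (X t w))%:E.
Proof.
move=> mE Eabove; have mE' := sub_gsigma_measurable (GT t) mE.
have X_gta w : E w -> (a < X t w)%R by move=> /Eabove/(_ t (leqnn t)).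
have X_gt0 w : E w -> (0 < X t w)%R by move=> /X_gta; exact: lt_trans.
(* The inverse of $X_t$ on [E], in a form that is measurable on the whole line. *)
pose h w := expR (- ln (X t w)).
have hE w : E w -> h w = (X t w)^-1%R.
  by move=> Ew; rewrite /h expRN lnK// posrE X_gt0.
have mh : @measurable_fun _ _ (g_sigma_algebraType (history X t)) _ E h.
  apply: measurable_funTS; apply: measurableT_comp => //.
  apply: measurableT_comp => //; apply: measurableT_comp => //.
  exact: measurable_history.
pose f w := (Num.max (X t.+1 w) a + delta * X t w)%R.
have mf : measurable_fun setT f.
  by apply: measurable_funD; [exact: measurable_maxr|exact: measurable_funM].
have f0 w : E w -> (0 <= f w)%R.
  move=> Ew; rewrite addr_ge0//; first by rewrite le_max (ltW a_gt0) orbT.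
  by rewrite mulr_ge0// ltW// X_gt0.
have : \int[P]_(w in E) (h w * f w)%:E <= \int[P]_(w in E) (h w * X t w)%:E.
  apply: (le_integral_weight P (GT t)) => //.
  - by move=> w Ew; rewrite ltW// X_gt0.
  - by move=> w _; exact: expR_ge0.
  - by move=> A mA AE; apply: drift_integral => //; exact: subset_trans AE Eabove.
have -> : \int[P]_(w in E) (h w * X t w)%:E = P E.
  rewrite -[RHS]mul1e -integral_cst//; apply: eq_integral => w /[!inE] Ew.
  by rewrite hE// mulVf// gt_eqF// X_gt0.
move=> hf.
have PE : P E \is a fin_num by exact: fin_num_measure.
rewrite -(leeD2rE _ _ PE).
have mpot i : measurable_fun E (fun w => (potential (X i w))%:E).
  by apply/measurable_EFinP/measurable_funTS/measurableT_comp => //; exact: measurable_potential.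
have pot0 i w : E w -> 0 <= (potential (X i w))%:E.
  by rewrite lee_fin potential_ge0.
have mhE : measurable_fun E h by exact: (sub_gsigma_measurable_fun (GT t) mh).
have mhf : measurable_fun E (fun w => (h w * f w)%:E).
  by apply/measurable_EFinP; apply: measurable_funM => //; exact: measurable_funTS.
have hf0 w : E w -> 0 <= (h w * f w)%:E.
  by move=> Ew; rewrite lee_fin mulr_ge0 ?expR_ge0 ?f0.
apply: (@le_trans _ _ (\int[P]_(w in E) (potential (X t w))%:E +
    \int[P]_(w in E) (h w * f w)%:E)); last by rewrite leeD2l.
rewrite -addeA -{2}[P E]mul1e -muleDl//.
rewrite -EFinD -integral_cst// -!ge0_integralD//; first last.
- by move=> w _; rewrite lee_fin addr_ge0// ltW.
- by move=> w; exact: pot0.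
- by move=> w; exact: pot0.
apply: ge0_le_integral => //.
- by move=> w Ew; rewrite adde_ge0 ?pot0// lee_fin addr_ge0// ltW.
- exact: emeasurable_funD.
- exact: emeasurable_funD.
move=> w Ew; rewrite -!EFinD lee_fin /f mulrDr hE//.
have -> : ((X t w)^-1 * (delta * X t w) = delta)%R.
  by field; rewrite gt_eqF// X_gt0.
have := potential_le (X t w) (X t.+1 w) (X_gt0 w Ew) (X_gta w Ew).
lra.
Qed.

(** With $E_t = B \cap \{t < T\}$ the integrals of the potential satisfy
   $u_{t+1} + \delta P(E_t) \leq u_t$, because $E_{t+1} \subseteq E_t$ and
   the potential is nonnegative; the sum of the $P(E_t)$ is the integral of
   $T$ over [B]. *)
Lemma integral_hitting_time_le (B : set T) :
  (history X 0).-sigma.-measurable B ->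
  delta%:E * \int[P]_(w in B) hitting_time X a w <=
  \int[P]_(w in B) (potential (X 0%N w))%:E.
Proof.
move=> mB; have mB' := sub_gsigma_measurable (GT 0) mB.
have mabove t := sub_gsigma_measurable (GT t) (measurable_stays_above X a t).
pose E t := B `&` stays_above X a t.
have mE t : (history X t).-sigma.-measurable (E t).
  by apply: measurableI; [exact: (history_le X (leq0n t))|exact: measurable_stays_above].
have mE' t := sub_gsigma_measurable (GT t) (mE t).
have -> : \int[P]_(w in B) hitting_time X a w = \sum_(t <oo) P (E t).
  under eq_integral do rewrite hitting_time_series.
  rewrite integral_nneseries//; last first.
    by move=> t; apply/measurable_EFinP/measurable_funTS; exact: measurable_indic.
  apply: eq_eseriesr => t _; rewrite integral_indic//.
  by rewrite setIC.
pose u t := \int[P]_(w in E t) (potential (X t w))%:E.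
have u0 t : 0 <= u t by apply: integral_ge0 => w _; rewrite lee_fin potential_ge0.
have mpot i D : measurable_fun D (fun w => (potential (X i w))%:E).
  by apply/measurable_EFinP/measurable_funTS/measurableT_comp => //; exact: measurable_potential.
have step t : u t.+1 + delta%:E * P (E t) <= u t.
  apply: le_trans (log_drift_integral t (E t) (mE t) (@subIsetr _ _ _)).
  rewrite leeD2r//; apply: ge0_subset_integral => //.
  - by move=> w _; rewrite lee_fin potential_ge0.
  - by move=> w [Bw abv]; split => // i it; apply: abv; exact: leqW.
have sum_le n : u n + \sum_(0 <= t < n) delta%:E * P (E t) <= u 0%N.
  elim: n => [|n IH]; first by rewrite big_nil adde0.
  by rewrite big_nat_recr//= [X in _ + X]addeC addeA (le_trans _ IH)// leeD2r.
rewrite -nneseriesZl//.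
apply: (@le_trans _ _ (u 0%N)); last first.
  apply: ge0_subset_integral => //; last exact: subIsetl.
  by move=> w _; rewrite lee_fin potential_ge0.
apply: lime_le; first by apply: is_cvg_nneseries => n _ _; rewrite mule_ge0// lee_fin ltW.
apply: nearW => n; apply: le_trans (sum_le n).
by rewrite leeDr.
Qed.

End drift.

Theorem corollary12 (d : measure_display) (Omega : measurableType d)
    (R : realType) (P : probability Omega R)
    (X : nat -> {RV P >-> R}) (xmin : R) (xmin_gt0 : (0 < xmin)%R)
    (Xge : forall t : nat,
      {ae P, forall w, t%:R%:E <= hitting_time X xmin w -> (xmin <= X t w)%R})
    (delta : R) (delta_gt0 : (0 < delta)%R)
    (drift : forall t : nat,
      {ae P, forall w, t%:R%:E < hitting_time X xmin w ->
        (X t w)%:E - condexp P (history X t) (EFin \o X t.+1) w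
          >= (delta * X t w)%:E}) :
  {ae P, forall w, condexp P (history X 0) (hitting_time X xmin) w
                     <= (ln (X 0%N w / xmin) / delta)%:E}.
Proof.
have mX t : measurable_fun setT (X t) by [].
have GT := @history_measurable _ _ R X 0 mX.
set tau := hitting_time X xmin.
have mtau : measurable_fun setT tau.
  have -> : tau = fun w => \sum_(t <oo) (\1_(stays_above X xmin t) w)%:E.
    by apply/funext => w; exact: hitting_time_series.
  apply: ge0_emeasurable_sum => [t w _ _|t _]; first by rewrite lee_fin.
  apply/measurable_EFinP.
  apply: measurable_indic; apply: (sub_gsigma_measurable (@history_measurable _ _ R X t mX)).
  exact: measurable_stays_above.
have tau_pos : tau^\+ = tau.
  by apply/funext => w; rewrite funeposE max_l// hitting_time_ge0.
have [mp p0 intp] := condexp_ge0P P GT mtau (hitting_time_ge0 X xmin).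
have [_ n0 _] := condexp_ge0P P GT (measurable_funeneg mtau) (fun w => funeneg_ge0 tau w).
have bound : {ae P, forall w, condexp_ge0 P (history X 0) tau w <=
    (potential xmin (X 0%N w) / delta)%:E}.
  apply: (ae_le_integral GT mp) => //.
  - apply: measurable_funM => //; apply: measurableT_comp.
      exact: measurable_potential.
    exact: measurable_history.
  - by move=> w; rewrite divr_ge0 ?potential_ge0// ltW.
  move=> A mA; rewrite intp//.
  have mA' := sub_gsigma_measurable GT mA.
  under [leRHS]eq_integral do rewrite mulrC EFinM.
  rewrite ge0_integralZl//; first last.
  - by rewrite lee_fin invr_ge0 ltW.
  - by move=> w _; rewrite lee_fin potential_ge0.
  - apply/measurable_EFinP/measurable_funTS/measurableT_comp => //.
    exact: measurable_potential.
  rewrite lee_pdivlMl//.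
  exact: integral_hitting_time_le.
apply: filterS2 (Xge 0%N) bound => w X0.
have {}X0 : (xmin <= X 0%N w)%R by apply: X0; exact: hitting_time_ge0.
rewrite /potential max_l//; apply: le_trans.
by rewrite /condexp tau_pos -[leRHS]adde0 leeD// oppe_le0.
Qed.
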